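(* Let $n\ge 3$ and let $\mathcal{B}\in\mathbb{R}^{n\times n}$ be the matrix defined in the context. The eigenvalues of $\mathcal{B}$ are $\lambda_j=\mathrm{i}x_j$, $j=1,\dots,n$, where $x_1,\dots,x_n$ are the $n$ (complex) roots of $$U_{n-1}(x)+\mathrm{i}U_{n-2}(x)-\mathrm{i}T_n(x)+T_{n-1}(x)=0 .$$ For each $\lambda_j$, the corresponding eigenvector is $P_j=[p_{j,0},\dots,p_{j,n-1}]^\top$ with $$p_{j,k}=\mathrm{i}^k U_k(x_j),\qquad k=0,\dots,n-1,$$ where $p_{j,0}=1$ is assumed for normalization.
   Context: $\mathrm{i}=\sqrt{-1}$. $T_k$ and $U_k$ denote the Chebyshev polynomials of the first and second kind, of degree $k$, characterized by $T_k(\cos\theta)=\cos(k\theta)$ and $U_k(\cos\theta)=\sin((k+1)\theta)/\sin\theta$, regarded as polynomials in a complex variable. $\mathcal{B}=(\mathcal{B}_{jk})_{j,k=1}^n$ is the real $n\times n$ matrix ($n\ge 3$ is the number of time steps) whose only nonzero entries are: for $1\le j\le n-1$, $\mathcal{B}_{j,j+1}=\tfrac12$; for $2\le j\le n-1$, $\mathcal{B}_{j,j-1}=-\tfrac12$; and in the last row $\mathcal{B}_{n,n-2}=\tfrac12$, $\mathcal{B}_{n,n-1}=-2$, $\mathcal{B}_{n,n}=\tfrac32$. *)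

(* Defs.v *)
From HB Require Import structures.
From mathcomp Require Import all_boot all_order all_algebra.
From mathcomp Require Import all_classical all_reals all_analysis.
From mathcomp Require Import complex ring lra.

Set Implicit Arguments.
Unset Strict Implicit.
Unset Printing Implicit Defensive.

Import Order.TTheory GRing.Theory Num.Theory.
Local Open Scope classical_set_scope.
Local Open Scope ring_scope.
Local Open Scope complex_scope.

Section Chebyshev.
Variable R : realType.
Implicit Types (k : nat) (p q : {poly R}) (t : R).

Definition is_chebyshevT k p : Prop :=
  forall t, p.[cos t] = cos (k%:R * t).

(* [x / 0 = 0] in MathComp, so the points with [sin t = 0] are left out. *)
Definition is_chebyshevU k p : Prop :=
  forall t, sin t != 0 -> p.[cos t] = sin (k.+1%:R * t) / sin t.

(* These predicates determine a unique polynomial: see [chebyshevTP],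
   [chebyshevUP] (existence) and [chebyshevT_unique], [chebyshevU_unique],
   so the default value 0 is never used. *)
Definition chebyshevT k : {poly R} := xget 0 [set p | is_chebyshevT k p].
Definition chebyshevU k : {poly R} := xget 0 [set p | is_chebyshevU k p].

Lemma chebyshevTP k : is_chebyshevT k (chebyshevT k).
Proof.
apply: (@xgetPex _ 0 [set p | is_chebyshevT k p]).
suff [p [q [hp _]]] : exists p q, is_chebyshevT k p /\ is_chebyshevT k.+1 q.
  by exists p.
elim: k => [|k [p [q [hp hq]]]].
  exists 1, 'X; split=> t; first by rewrite hornerC mul0r cos0.
  by rewrite hornerX mul1r.
exists q, (2%:P * 'X * q - p); split=> // t.
rewrite !hornerE hp hq.
have -> : k.+2%:R * t = k.+1%:R * t + t by rewrite -[k.+2]addn1 natrD; ring.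
have -> : k%:R * t = k.+1%:R * t - t by rewrite -[k.+1]addn1 natrD; ring.
by rewrite cosB cosD; ring.
Qed.

Lemma chebyshevUP k : is_chebyshevU k (chebyshevU k).
Proof.
apply: (@xgetPex _ 0 [set p | is_chebyshevU k p]).
suff [p [q [hp _]]] : exists p q, is_chebyshevU k p /\ is_chebyshevU k.+1 q.
  by exists p.
elim: k => [|k [p [q [hp hq]]]].
  exists 1, (2%:P * 'X); split=> t st; first by rewrite hornerC mul1r divff.
  rewrite !hornerE.
  have -> : 2%:R * t = t + t by ring.
  by rewrite sinD; field.
exists q, (2%:P * 'X * q - p); split=> // t st.
rewrite !hornerE hp // hq //.
have -> : k.+3%:R * t = k.+2%:R * t + t by rewrite -[k.+3]addn1 natrD; ring.
have -> : k.+1%:R * t = k.+2%:R * t - t by rewrite -[k.+2]addn1 natrD; ring.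
by rewrite sinB sinD; field.
Qed.

Lemma eq_poly_cos p q :
  (forall t, sin t != 0 -> p.[cos t] = q.[cos t]) -> p = q.
Proof.
move=> pq; apply/eqP; rewrite -subr_eq0; apply: contraT => nz.
pose f (i : nat) : R := i.+2%:R^-1.
have fi : injective f.
  by move=> i j /invr_inj /eqP; rewrite eqr_nat => /eqP [].
have f0 i : 0 < f i by rewrite invr_gt0 ltr0n.
have f1 i : f i < 1 by rewrite invf_lt1 ?ltr0n // ltr1n.
pose s := [seq f i | i <- iota 0 (size (p - q))].
have us : uniq s by rewrite map_inj_uniq // iota_uniq.
have rs : all (root (p - q)) s.
  apply/allP => _ /mapP[i _ ->]; rewrite rootE.
  have fin : f i \in `[-1, 1].
    by rewrite in_itv /=; apply/andP; split; move: (f0 i) (f1 i); lra.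
  rewrite -(acosK fin) !hornerE pq ?subrr //.
  apply/eqP => s0; have := cos2Dsin2 (acos (f i)).
  rewrite s0 acosK // expr0n addr0 => h.
  by have := f0 i; have := f1 i; nra.
by have := max_poly_roots nz rs us; rewrite size_map size_iota ltnn.
Qed.

Lemma chebyshevT_unique k p : is_chebyshevT k p -> p = chebyshevT k.
Proof. by move=> hp; apply: eq_poly_cos => t _; rewrite hp chebyshevTP. Qed.

Lemma chebyshevU_unique k p : is_chebyshevU k p -> p = chebyshevU k.
Proof. by move=> hp; apply: eq_poly_cos => t h; rewrite hp // chebyshevUP. Qed.

End Chebyshev.

Section Spectrum.
Variable F : fieldType.

(* [x] lists the roots of [p], each repeated according to its multiplicity. *)
Definition roots_with_mult n (p : {poly F}) (x : 'I_n -> F) : Prop :=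
  p != 0 /\ p = lead_coef p *: \prod_(j < n) ('X - (x j)%:P).

Definition eigenvalues_with_mult n (A : 'M[F]_n) (a : 'I_n -> F) : Prop :=
  roots_with_mult (char_poly A) a.

(* Column eigenvectors; MathComp's [eigenspace] is about row vectors. *)
Definition is_eigenvector n (A : 'M[F]_n) (a : F) (v : 'cV[F]_n) : Prop :=
  v != 0 /\ A *m v = a *: v.

End Spectrum.

Section TimeMatrix.
Variable R : realType.

(* Indices start at 0: the entry in row [i], column [j] is B_{i+1,j+1}. *)
Definition Bmx n : 'M[R]_n := \matrix_(i < n, j < n)
  if (i.+1 < n)%N then
    if j == i.+1 :> nat then 2^-1
    else if i == j.+1 :> nat then - 2^-1
    else 0
  else
    if (j + 3 == n)%N then 2^-1
    else if (j + 2 == n)%N then - 2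
    else if (j + 1 == n)%N then 3 / 2
    else 0.

Definition BmxC n : 'M[R[i]]_n := map_mx (real_complex R) (Bmx n).

Definition chebyshevTC k : {poly R[i]} :=
  map_poly (real_complex R) (chebyshevT R k).
Definition chebyshevUC k : {poly R[i]} :=
  map_poly (real_complex R) (chebyshevU R k).

Definition charfun n : {poly R[i]} :=
  chebyshevUC n.-1 + 'i *: chebyshevUC n.-2
  - 'i *: chebyshevTC n + chebyshevTC n.-1.

Definition eigvec n (x : R[i]) : 'cV[R[i]]_n :=
  \col_(k < n) ('i ^+ k * (chebyshevUC k).[x]).

End TimeMatrix.

(* Main.v *)
Require Import Defs.
From mathcomp Require Import all_boot all_order all_algebra.
From mathcomp Require Import all_classical all_reals all_analysis.
From mathcomp Require Import complex ring.

Set Implicit Arguments.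
Unset Strict Implicit.
Unset Printing Implicit Defensive.

Import Order.TTheory GRing.Theory Num.Theory.
Local Open Scope ring_scope.
Local Open Scope complex_scope.

(** Away from its last row, the matrix B acts on a sequence v as the central
    difference (v_(k+1) - v_(k-1)) / 2, with v_(-1) = 0. An eigenvector for a
    therefore follows the recurrence v_(k+1) = 2 a v_k + v_(k-1), v_1 = 2 a v_0;
    for a = i x and v_0 = 1 this is the Chebyshev recurrence twisted by powers
    of i, with solution v_k = i^k U_k(x). In particular the first entry
    determines the eigenvector, so that the eigenspaces are lines
    ([Bmx_eigvec_head]).

    The last row of B is the same central difference with the missing v_n
    replaced by its quadratic extrapolation
    3 v_(n-1) - 3 v_(n-2) + v_(n-3). The recurrence thus solves every equation of
    (a - B) v = 0 but the last, which fails by half the third difference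
    of v ([Bmx_residual]). For v_k = i^k U_k(x) this third difference is
    2 i^(n-3) times the polynomial of the statement, because
    2 T_k = U_k - U_(k-2) ([cheb_seq_diff3]).

    Eigenvalues with multiplicity require an identity of polynomials. The
    recurrence makes sense over any commutative ring, and multiplying
    (a - B) v = r e_n by the adjugate of a - B gives
    det (a - B) v_0 = r cof_(n,1)(a - B), where the cofactor is that of a
    triangular matrix with constant diagonal ([det_Bmx]). Taking a = i X over
    the complex polynomials shows that the characteristic polynomial at i X is
    a nonzero constant times the polynomial of the statement
    ([char_poly_Bmx_comp]); the substitution X -> i X then matches the roots
    with their multiplicities ([roots_with_mult_scale]). *)

(** * Chebyshev polynomials *)

Lemma chebyshevU0 (R : realType) : chebyshevU R 0 = 1.
Proof.
by apply/esym/chebyshevU_unique => t st; rewrite hornerC mul1r divff.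
Qed.

Lemma chebyshevU1 (R : realType) : chebyshevU R 1 = 2%:R * 'X.
Proof.
apply/esym/chebyshevU_unique => t st; rewrite -polyC_natr !hornerE.
have -> : 2%:R * t = t + t by ring.
by rewrite sinD; field.
Qed.

Lemma chebyshevU_rec (R : realType) k :
  chebyshevU R k.+2 = 2%:R * 'X * chebyshevU R k.+1 - chebyshevU R k.
Proof.
apply/esym/chebyshevU_unique => t st.
rewrite -polyC_natr !hornerE !chebyshevUP //.
have -> : k.+3%:R * t = k.+2%:R * t + t by rewrite -[k.+3]addn1 natrD; ring.
have -> : k.+1%:R * t = k.+2%:R * t - t by rewrite -[k.+2]addn1 natrD; ring.
by rewrite sinB sinD; field.
Qed.

Lemma chebyshevT_U (R : realType) k :
  2%:R * chebyshevT R k.+2 = chebyshevU R k.+2 - chebyshevU R k.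
Proof.
apply: eq_poly_cos => t st.
rewrite -polyC_natr !hornerE chebyshevTP !chebyshevUP //.
have -> : k.+3%:R * t = k.+2%:R * t + t by rewrite -[k.+3]addn1 natrD; ring.
have -> : k.+1%:R * t = k.+2%:R * t - t by rewrite -[k.+2]addn1 natrD; ring.
by rewrite sinB sinD; field.
Qed.

(** * The matrix pencil of the time-stepping matrix *)

(** Third forward difference. It vanishes exactly when [v m.+3] is the quadratic
    extrapolation of the three preceding terms. *)
Definition diff3 (A : pzRingType) m (v : nat -> A) : A :=
  v m.+3 - 3%:R * v m.+2 + 3%:R * v m.+1 - v m.

(** The coefficients are pushed along [f] into an arbitrary commutative ring, so
    that the same computation serves complex vectors and vectors of
    polynomials. *)
Section MatrixPencil.
Variables (R : realType) (A : comNzRingType) (f : {rmorphism R -> A}).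
Variables (m : nat) (v : nat -> A).

Lemma Bmx_mul_inner (i : 'I_m.+3) : (i.+1 < m.+3)%N ->
  (map_mx f (Bmx R m.+3) *m \col_k v k) i 0 =
    f 2^-1 * (v i.+1 - (if i : nat is j.+1 then v j else 0)).
Proof.
move=> hi; rewrite mxE.
under eq_bigr => j _ do rewrite !mxE hi.
(* The two nested tests of the matrix entry exclude each other. *)
rewrite (eq_bigr (fun j : 'I_m.+3 =>
   (if j == i.+1 :> nat then f 2^-1 * v j else 0)
   - (if i == j.+1 :> nat then f 2^-1 * v j else 0))); last first.
  move=> j _; case: eqP => [->|_]; last case: eqP => _.
  - by rewrite [X in if X then _ else _]eqn_leq ltnNge leqnSn andbF subr0.
  - by rewrite rmorphN sub0r mulNr.
  - by rewrite rmorph0 mul0r subr0.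
rewrite big_split sumrN /= mulrBr; congr (_ - _).
  by rewrite -big_mkcond (big_pred1 (Ordinal hi)) //=.
case: i hi => -[|i] /= lt_i _; first by rewrite mulr0 big1.
by rewrite -big_mkcond (big_pred1 (Ordinal (ltnW lt_i))) //= => j;
  rewrite eqSS eq_sym.
Qed.

Lemma Bmx_mul_last :
  (map_mx f (Bmx R m.+3) *m \col_k v k) ord_max 0 =
    f 2^-1 * (v m - 4%:R * v m.+1 + 3%:R * v m.+2).
Proof.
rewrite mxE.
under eq_bigr => j _ do rewrite !mxE /= ltnn.
rewrite !big_ord_recr /= big1 ?add0r => [|j _].
  rewrite !addnS !addn0 !eqxx !eqSS.
  rewrite !(gtn_eqF (ltnSn _)) (gtn_eqF (ltnW (ltnSn _))) /=.
  have f2 : f 2 = 4%:R * f 2^-1.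
    by rewrite -(rmorph_nat f) -rmorphM; congr (f _); field.
  by rewrite rmorphM rmorphN f2 rmorph_nat; ring.
rewrite !addnS !addn0 !eqSS.
have lt_j := ltn_ord j.
by rewrite !ltn_eqF ?rmorph0 ?mul0r // ltnW // ltnW.
Qed.

(** In every row but the last the recurrence is the eigenvalue equation. In the
    last one it would be so with [v m.+3] in place of its quadratic
    extrapolation, whence the third difference. *)
Lemma Bmx_residual a : v 1%N = 2%:R * a * v 0%N ->
    (forall k, v k.+2 = 2%:R * a * v k.+1 + v k) ->
  (a%:M - map_mx f (Bmx R m.+3)) *m \col_k v k
  = (f 2^-1 * diff3 m v) *: delta_mx ord_max 0.
Proof.
move=> v1 vS; have half2 : f 2^-1 * 2%:R = 1.
  by rewrite -(rmorph_nat f) -rmorphM mulVf ?rmorph1 // pnatr_eq0.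
(* The recurrence gives [2 a v k], hence the factor 2 made visible here. *)
have aE y : a * y = f 2^-1 * (2%:R * a * y).
  by rewrite !mulrA half2 mul1r.
apply/matrixP => i j; rewrite ord1 mulmxBl mul_scalar_mx !mxE eqxx andbT.
rewrite aE; have [i_lt|] := ltnP i.+1 m.+3.
  have := Bmx_mul_inner i_lt; rewrite mxE => ->.
  have -> : i == ord_max = false.
    by apply/negbTE; rewrite -val_eqE neq_ltn -ltnS i_lt.
  case: i i_lt => -[|i] /= _ _; first by rewrite v1; ring.
  by rewrite vS; ring.
rewrite ltnS => i_ge.
have -> : i = ord_max by apply/val_inj/eqP; rewrite eqn_leq -ltnS ltn_ord.
have := Bmx_mul_last; rewrite mxE => -> /=.
by rewrite eqxx /= mulr1 /diff3 (vS m.+1); ring.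
Qed.

(** Applying the adjugate to the residual equation turns its right-hand side
    into the adjugate's last column, whose head entry is the minor without the
    last row and the first column. That minor is triangular with the
    superdiagonal of [a - B], constantly [- f 2^-1], on its diagonal. *)
Lemma det_Bmx a : v 0%N = 1 -> v 1%N = 2%:R * a ->
    (forall k, v k.+2 = 2%:R * a * v k.+1 + v k) ->
  \det (a%:M - map_mx f (Bmx R m.+3)) = f 2^-1 ^+ m.+3 * diff3 m v.
Proof.
move=> v0 v1 vS; set M := _ - _.
have v1' : v 1%N = 2%:R * a * v 0%N by rewrite v0 mulr1.
have Mv := Bmx_residual v1' vS.
have /matrixP/(_ ord0 ord0) := congr1 (mulmx (\adj M)) Mv.
rewrite mulmxA mul_adj_mx mul_scalar_mx -scalemxAr -colE.
rewrite !mxE v0 mulr1 => ->; rewrite mulrC mulrA; congr (_ * _).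
rewrite /cofactor /= addn0 det_trig; last first.
  apply/is_trig_mxP => i j lt_ij; rewrite !mxE -!val_eqE /=.
  rewrite /bump leqNgt ltn_ord add0n /= add1n eqSS ltnS ltn_ord.
  rewrite (gtn_eqF lt_ij) !(ltn_eqF (leqW _)) ?(leqW lt_ij) //.
  by rewrite rmorph0 subr0.
(* The cofactor sign (-1)^(m+2) cancels the signs of the m + 2 diagonal entries. *)
rewrite (eq_bigr (fun=> - f 2^-1)) => [|i _].
  by rewrite prodr_const card_ord -exprMn mulN1r opprK -exprSr.
rewrite !mxE -!val_eqE /= /bump leqNgt ltn_ord add0n add1n ltnS ltn_ord eqxx.
by rewrite ltn_eqF // sub0r.
Qed.

(** Every row but the last expresses an entry of an eigenvector by the two
    preceding ones, so the first entry determines all of them. *)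
Lemma Bmx_eigvec_head a :
    map_mx f (Bmx R m.+3) *m \col_(k < m.+3) v k = a *: \col_k v k ->
  v 0%N = 0 -> \col_(k < m.+3) v k = 0.
Proof.
move=> eqv v0; have half2 : 2%:R * f 2^-1 = 1.
  by rewrite -(rmorph_nat f) -rmorphM divff ?rmorph1 // pnatr_eq0.
suff v_eq0 k : (k.+1 < m.+3)%N -> v k = 0 /\ v k.+1 = 0.
  apply/colP => -[[|k] lt_k]; rewrite !mxE //=.
  by case: (v_eq0 _ lt_k).
elim: k => [|k IH] lt_k; have := Bmx_mul_inner (i := Ordinal (ltnW lt_k)) lt_k;
  rewrite eqv !mxE /=.
  rewrite v0 subr0 mulr0 => /(congr1 ( *%R 2%:R)).
  by rewrite mulr0 mulrA half2 mul1r.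
have [-> ->] := IH (ltnW lt_k).
rewrite subr0 mulr0 => /(congr1 ( *%R 2%:R)).
by rewrite mulr0 mulrA half2 mul1r.
Qed.

End MatrixPencil.

(** * Lists of roots *)

Section Roots.
Variable F : fieldType.

Lemma roots_with_multP n (p : {poly F}) (x : 'I_n -> F) :
  roots_with_mult p x <->
  exists2 c, c != 0 & p = c *: \prod_(j < n) ('X - (x j)%:P).
Proof.
split=> [[p0 pE]|[c c0 ->]]; last first.
  have monP : \prod_(j < n) ('X - (x j)%:P) \is monic.
    exact: monic_prod_XsubC.
  split; first by rewrite scaler_eq0 negb_or c0 monic_neq0.
  by rewrite lead_coefZ (monicP monP) mulr1.
by exists (lead_coef p); rewrite ?lead_coef_eq0.
Qed.

Lemma roots_with_mult_scale n (p : {poly F}) (x : 'I_n -> F) b c :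
    b != 0 -> c != 0 -> roots_with_mult p x ->
  roots_with_mult (c *: (p \Po (b *: 'X))) (fun j => b^-1 * x j).
Proof.
move=> b0 c0 /roots_with_multP[d d0 ->]; apply/roots_with_multP.
exists (c * d * b ^+ n); first by rewrite !mulf_neq0 ?expf_neq0.
rewrite comp_polyZ rmorph_prod /= -!scalerA -[in b ^+ n](card_ord n).
rewrite -prodr_const -scaler_prod; congr (_ *: (_ *: _)).
apply: eq_bigr => j _; rewrite comp_polyB comp_polyX comp_polyC.
by rewrite scalerBr -[_ *: _%:P]mul_polyC -polyCM mulVKf.
Qed.

Lemma closed_roots_with_mult (K : closedFieldType) n (p : {poly K}) :
  size p = n.+1 -> exists x : 'I_n -> K, roots_with_mult p x.
Proof.
move=> sz; have p0 : p != 0 by rewrite -size_poly_eq0 sz.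
have [r pE] := closed_field_poly_normal p.
have szr : size r = n.
  move: sz; rewrite pE size_scale ?lead_coef_eq0 // size_prod_XsubC.
  by case.
exists (fun j => r`_j); split=> //.
by rewrite {1}pE (big_nth 0) szr big_mkord.
Qed.

Lemma root_roots_with_mult n (p : {poly F}) (x : 'I_n -> F) a :
  roots_with_mult p x -> root p a <-> exists j, a = x j.
Proof.
move=> /roots_with_multP[c c0 ->].
rewrite rootZ // -(big_map x xpredT (fun y => 'X - y%:P)) root_prod_XsubC; split.
  by case/mapP => j _ ->; exists j.
by case=> j ->; apply: map_f; rewrite mem_index_enum.
Qed.

End Roots.

(** * The twisted Chebyshev sequence *)

Section TwistedChebyshev.
Variable R : realType.
Local Notation U := (chebyshevUC R).

Lemma chebyshevUC0 : U 0 = 1.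
Proof. by rewrite /chebyshevUC chebyshevU0 rmorph1. Qed.

Lemma chebyshevUC1 : U 1 = 2%:R * 'X.
Proof.
by rewrite /chebyshevUC chebyshevU1 rmorphM rmorph_nat /= map_polyX.
Qed.

Lemma chebyshevUC_rec k : U k.+2 = 2%:R * 'X * U k.+1 - U k.
Proof.
by rewrite /chebyshevUC chebyshevU_rec rmorphB !rmorphM rmorph_nat /= map_polyX.
Qed.

Lemma chebyshevTC_U k : 2%:R * chebyshevTC R k.+2 = U k.+2 - U k.
Proof. by rewrite -[RHS]rmorphB -chebyshevT_U rmorphM rmorph_nat. Qed.

(** The eigenvector [eigvec n x] with the point [x] kept as the indeterminate. *)
Definition cheb_seq k : {poly R[i]} := 'i ^+ k *: U k.

Lemma polyi2 : ('i%:P : {poly R[i]}) * 'i%:P = -1.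
Proof. by rewrite -polyCM -expr2 sqr_i polyCN. Qed.

Lemma cheb_seq0 : cheb_seq 0 = 1.
Proof. by rewrite /cheb_seq chebyshevUC0 expr0 scale1r. Qed.

Lemma cheb_seq1 : cheb_seq 1 = 2%:R * ('i *: 'X).
Proof. by rewrite /cheb_seq chebyshevUC1 -!mul_polyC; ring. Qed.

(** Twisting by powers of [i] turns the minus sign of the Chebyshev recurrence
    into a plus sign. *)
Lemma cheb_seq_rec k :
  cheb_seq k.+2 = 2%:R * ('i *: 'X) * cheb_seq k.+1 + cheb_seq k.
Proof.
rewrite /cheb_seq chebyshevUC_rec -!mul_polyC !rmorphXn !exprS !mulrA polyi2.
by rewrite (_ : 2%:R * 'i%:P * 'X * 'i%:P = 2%:R * 'X * ('i%:P * 'i%:P));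
  [rewrite polyi2|]; ring.
Qed.

Lemma polyi2_mul (w : {poly R[i]}) : 'i%:P * ('i%:P * w) = - w.
Proof. by rewrite mulrA polyi2 mulN1r. Qed.

(** Up to the factor [i ^ m], the third difference is
    3 U_(m+2) + 3 i U_(m+1) - i U_(m+3) - U_m. Grouping
    U_(m+3) - U_(m+1) = 2 T_(m+3) and U_(m+2) - U_m = 2 T_(m+2) leaves
    2 U_(m+2) + 2 i U_(m+1). *)
Lemma cheb_seq_diff3 m :
  diff3 m cheb_seq = (2%:R * 'i ^+ m) *: charfun R m.+3.
Proof.
have cE k : cheb_seq k = 'i%:P ^+ k * U k.
  by rewrite /cheb_seq -mul_polyC rmorphXn.
rewrite /diff3 /charfun !cE !exprS !polyi2_mul -!mul_polyC /=.
rewrite polyCM polyC_natr rmorphXn /=.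
move: ('i%:P ^+ m) => z; move: 'i%:P => I.
transitivity (z * (2%:R * U m.+2 + 2%:R * (I * U m.+1)
  - I * (U m.+3 - U m.+1) + (U m.+2 - U m))); first by ring.
by rewrite -!chebyshevTC_U; ring.
Qed.

Section Pencil.
Variable m : nat.
Local Notation B := (BmxC R m.+3).

Lemma BmxC_polyC :
  map_mx polyC B = map_mx (polyC \o real_complex R) (Bmx R m.+3).
Proof. by rewrite -map_mx_comp. Qed.

(** The pencil is evaluated at [i X] rather than [X], so that its solution is
    [cheb_seq] without any change of variable. *)
Lemma char_poly_Bmx_comp :
  char_poly B \Po ('i *: 'X) =
    (2%:R * 'i ^+ m * (2^-1) ^+ m.+3) *: charfun R m.+3.
Proof.
rewrite /char_poly -det_map_mx /char_poly_mx map_mxB map_scalar_mx /= comp_polyX.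
have -> : map_mx (comp_poly ('i *: 'X)) (map_mx polyC B) = map_mx polyC B.
  by apply/matrixP => i j; rewrite !mxE comp_polyC.
rewrite BmxC_polyC (det_Bmx _ _ cheb_seq0 cheb_seq1 cheb_seq_rec).
rewrite cheb_seq_diff3 /= fmorphV rmorph_nat.
by rewrite -rmorphXn mul_polyC scalerA mulrC.
Qed.

(** Evaluation at [x] of the residual of [cheb_seq]. *)
Lemma eigvec_residual (x : R[i]) :
  (('i * x)%:M - B) *m eigvec m.+3 x
  = ('i ^+ m * (charfun R m.+3).[x]) *: delta_mx ord_max 0.
Proof.
have Br := @Bmx_residual _ _ (polyC \o real_complex R) m cheb_seq ('i *: 'X).
rewrite cheb_seq0 mulr1 in Br.
have := congr1 (map_mx (horner_eval x)) (Br cheb_seq1 cheb_seq_rec).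
rewrite -BmxC_polyC map_mxM map_mxB map_scalar_mx map_mxZ map_delta_mx /=.
have -> : map_mx (horner_eval x) (map_mx polyC B) = B.
  by apply/matrixP => i j; rewrite !mxE [LHS]hornerC.
have -> : map_mx (horner_eval x) (\col_k cheb_seq k) = eigvec m.+3 x.
  by apply/matrixP => i j; rewrite !mxE [LHS]hornerZ.
rewrite cheb_seq_diff3 /= fmorphV rmorph_nat /horner_eval hornerM hornerC.
by rewrite hornerZ hornerX (hornerZ _ (charfun _ _)) -[2%:R * _ * _]mulrA mulKf
           ?pnatr_eq0.
Qed.

End Pencil.

End TwistedChebyshev.

(** * Eigenvalues and eigenvectors *)

Theorem theorem3p1 (R : realType) (n : nat) (hn : (3 <= n)%N) :
  (exists x : 'I_n -> R[i], roots_with_mult (charfun R n) x) /\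
  forall x : 'I_n -> R[i], roots_with_mult (charfun R n) x ->
    [/\ eigenvalues_with_mult (BmxC R n) (fun j => 'i * x j),
        forall a : R[i], eigenvalue (BmxC R n) a <-> exists j, a = 'i * x j
      & forall j : 'I_n,
        [/\ is_eigenvector (BmxC R n) ('i * x j) (eigvec n (x j)),
            forall k : 'I_n, k = 0%N :> nat -> eigvec n (x j) k 0 = 1
          & forall v : 'cV[R[i]]_n, is_eigenvector (BmxC R n) ('i * x j) v ->
              exists c : R[i], v = c *: eigvec n (x j)]].
Proof.
case: n hn => [|[|[|m]]] // _.
have i0 : 'i != 0 :> R[i].
  apply/eqP => i0; have /eqP := sqr_i R.
  by rewrite i0 expr0n eq_sym oppr_eq0 oner_eq0.
set c := 2%:R * 'i ^+ m * 2^-1 ^+ m.+3 : R[i].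
have c0 : c != 0.
  rewrite mulf_neq0 // ?expf_neq0 ?invr_eq0 ?pnatr_eq0 //.
  by rewrite mulf_neq0 ?expf_neq0 ?pnatr_eq0.
have cV0 : c^-1 != 0 by rewrite invr_eq0.
have charE : charfun R m.+3 = c^-1 *: (char_poly (BmxC R m.+3) \Po ('i *: 'X)).
  by rewrite char_poly_Bmx_comp scalerA mulVf // scale1r.
split.
  have [x Hx] := closed_roots_with_mult (size_char_poly (BmxC R m.+3)).
  by rewrite charE; eexists; apply: roots_with_mult_scale Hx.
move=> x Hx.
(* Substituting [X / i] in [charE] recovers the characteristic polynomial. *)
have eig : eigenvalues_with_mult (BmxC R m.+3) (fun j => 'i * x j).
  have iV0 : 'i^-1 != 0 :> R[i] by rewrite invr_eq0.
  have := roots_with_mult_scale iV0 c0 Hx; rewrite invrK /eigenvalues_with_mult.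
  rewrite charE comp_polyZ scalerA divff // scale1r -comp_polyA comp_polyZ.
  by rewrite comp_polyX scalerA divff // scale1r comp_polyXr.
have eigvec0 j : eigvec m.+3 (x j) 0 0 = 1.
  by rewrite mxE expr0 mul1r chebyshevUC0 hornerC.
have eigvecE j :
    BmxC R m.+3 *m eigvec m.+3 (x j) = ('i * x j) *: eigvec m.+3 (x j).
  apply/esym/eqP; rewrite -subr_eq0 -mul_scalar_mx -mulmxBl eigvec_residual.
  have /eqP -> : root (charfun R m.+3) (x j).
    by apply/(root_roots_with_mult _ Hx); exists j.
  by rewrite mulr0 scale0r.
split=> //.
  by move=> a; rewrite eigenvalue_root_char; apply: root_roots_with_mult eig.
move=> j; split.
- split=> //; apply/eqP => /matrixP/(_ 0 0)/eqP.
  by rewrite eigvec0 mxE oner_eq0.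
- by move=> k k0; rewrite (_ : k = 0) //; apply: val_inj.
(* Subtracting [v 0 0] times the known eigenvector makes the first entry 0. *)
move=> v [_ Hv]; exists (v 0 0); apply/eqP; rewrite -subr_eq0; apply/eqP.
set w := _ - _.
have wE : w = \col_(k < m.+3) w (inord k) 0.
  by apply/colP => k; rewrite mxE inord_val.
rewrite wE; apply: (Bmx_eigvec_head (f := real_complex R) (a := 'i * x j)
                       (v := fun k => w (inord k) 0)).
  rewrite -wE -[map_mx _ _]/(BmxC R m.+3) mulmxBr -scalemxAr Hv eigvecE.
  by rewrite scalerBr !scalerA [_ * v 0 0]mulrC.
rewrite (_ : inord 0 = 0); last by apply/val_inj; rewrite /= inordK.
by rewrite !mxE expr0 mul1r chebyshevUC0 hornerC mulr1 subrr.
Qed.
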